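(* Given an instance with mixed goods and chores in which every agent's valuation is lexicographical, an allocation $X$ is EFX if and only if it is PMMS.
   Context: Mixed setting: $N=[n]$ is a finite set of agents, $M$ a finite set of $m$ indivisible items, and each agent $i$ has an additive valuation $u_i:2^M\to\mathbb{R}$ (item values may be positive or negative). An item $g$ is a good for agent $i$ if $u_i(g)\ge0$ and a chore for agent $i$ otherwise; $G_i$ and $C_i$ denote the sets of goods and chores for agent $i$. An allocation $X=(X_1,\dots,X_n)$ is a partition of $M$ into $n$ (possibly empty) bundles. Lexicographical valuation: an additive valuation $u$ is lexicographical if the items can be ordered $g_1,\ldots,g_m$ such that $u(g_k)\in\{2^{m-k},-2^{m-k}\}$ for every $k$. (The order and the signs may differ between agents.) EFX: agent $i$ envies agent $j$ if $u_i(X_i)<u_i(X_j)$. The allocation $X$ is EFX if for every pair of agents $i,j$ such that $i$ envies $j$: (i) for each $g\in G_i\cap X_j$, $u_i(X_i)\ge u_i(X_j\setminus\{g\})$; and (ii) for each $g\in C_i\cap X_i$, $u_i(X_i\setminus\{g\})\ge u_i(X_j)$. PMMS: for $S\subseteq M$ let $\mu_i(2,S)=\max_{(P_1,P_2)\in\Pi_2(S)}\min\{u_i(P_1),u_i(P_2)\}$, where $\Pi_2(S)$ is the set of ordered bipartitions of $S$ (parts may be empty). The allocation $X$ is PMMS if $u_i(X_i)\ge\mu_i(2,X_i\cup X_j)$ for all $i\ne j$. *)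

(* Defs.v *)
From mathcomp Require Import all_boot all_order all_algebra.

Set Implicit Arguments.
Unset Strict Implicit.
Unset Printing Implicit Defensive.

Import Order.TTheory GRing.Theory Num.Theory.
Local Open Scope ring_scope.

Section Valuation.
Variables (R : realFieldType) (M : finType).
Implicit Types (u : {set M} -> R) (S : {set M}).

Definition additive_valuation u : Prop :=
  forall S, u S = \sum_(g in S) u [set g].

Definition goods u : {set M} := [set g | 0 <= u [set g]].
Definition chores u : {set M} := [set g | u [set g] < 0].

(* The ordering [g_1, ..., g_m] is indexed from 0 by ['I_m], m = #|M|, so that
   the item [order k] is g_(k+1), of absolute value 2 ^ (m - (k + 1)). *)
Definition lexicographical u : Prop :=
  additive_valuation u /\
  exists2 order : 'I_#|M| -> M, bijective order &
    forall k : 'I_#|M|,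
      u [set order k] = 2 ^+ (#|M| - k.+1) \/
      u [set order k] = - 2 ^+ (#|M| - k.+1).

Definition bipartitions S : {set {set M} * {set M}} :=
  [set P | (P.1 :|: P.2 == S) && [disjoint P.1 & P.2]].

(* The maximum is over a nonempty set: the default value of the iterated max is
   the term of the bipartition (S, set0). *)
Definition mms2 u S : R :=
  \big[Num.max/Num.min (u S) (u set0)]_(P in bipartitions S)
    Num.min (u P.1) (u P.2).

End Valuation.

Section Allocation.
Variables (R : realFieldType) (n : nat) (M : finType).
Implicit Types (u : 'I_n -> {set M} -> R) (X : 'I_n -> {set M}).

Definition allocation X : Prop :=
  \bigcup_(i < n) X i = [set: M] /\
  forall i j : 'I_n, i != j -> [disjoint X i & X j].

Definition envies u X (i j : 'I_n) : Prop := u i (X i) < u i (X j).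

Definition EFX u X : Prop :=
  forall i j : 'I_n, envies u X i j ->
    (forall g, g \in goods (u i) :&: X j -> u i (X j :\ g) <= u i (X i)) /\
    (forall g, g \in chores (u i) :&: X i -> u i (X j) <= u i (X i :\ g)).

Definition PMMS u X : Prop :=
  forall i j : 'I_n, i != j -> mms2 (u i) (X i :|: X j) <= u i (X i).

End Allocation.

(* Main.v *)
(* Fix a pair of bundles A, B and a lexicographical u.  Moving one good out of B
   or one chore out of A strictly improves A, which turns PMMS into EFX.
   Conversely, write u B - u A as a signed sum of distinct powers of 2 over
   S = A :|: B.  If A envies B, the top item h of S occurs with sign +; were
   another item g also to occur with sign +, then u B - u A would exceed
   2 |u g|, contradicting EFX.  So apart from h, A holds exactly the goods of S,
   and in any bipartition of S the part that agrees with A on h is worth at most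
   u A. *)
Require Import Defs.
From mathcomp Require Import all_boot all_order all_algebra.
From mathcomp Require Import lra.

Set Implicit Arguments.
Unset Strict Implicit.
Unset Printing Implicit Defensive.

Import Order.TTheory GRing.Theory Num.Theory.
Local Open Scope ring_scope.

Lemma sum_setU (V : nmodType) (I : finType) (A B : {set I}) (F : I -> V) :
  [disjoint A & B] ->
  \sum_(i in A :|: B) F i = \sum_(i in A) F i + \sum_(i in B) F i.
Proof. by move=> disAB; rewrite -bigU //; apply: eq_bigl => i; rewrite !inE. Qed.

Lemma disjoint_setU1D1 (T : finType) (x : T) (A B : {set T}) :
  [disjoint A & B] -> [disjoint x |: A & B :\ x].
Proof.
move=> disAB; rewrite -setI_eq0 setIUl setU_eq0 !setI_eq0 disjoints1 setD11 /=.
exact: disjointWr (subD1set _ _) disAB.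
Qed.

Section DistinctPowers.
Variables (R : realFieldType) (M : finType) (r : M -> nat).
Hypothesis r_inj : injective r.
Implicit Types (S : {set M}) (e : M -> R).

(** Induction on [k]: by injectivity of [r], at most one item of [S] has rank exactly [k]. It
    contributes [2 ^+ k], and the items of smaller rank sum to less than another [2 ^+ k]. *)
Lemma sum_distinct_pow2_lt k S : (forall x, x \in S -> (r x < k)%N) ->
  \sum_(x in S) 2 ^+ r x < 2 ^+ k :> R.
Proof.
elim: k S => [|k IHk] S ltS.
  by rewrite big1 ?expr0 ?ltr01 // => x /ltS.
have IH' (T : {set M}) : T \subset S -> (forall x, x \in T -> r x != k) ->
    \sum_(x in T) 2 ^+ r x < 2 ^+ k :> R.
  move=> /subsetP sTS neqk; apply: IHk => x xT.
  by rewrite ltn_neqAle neqk //= -ltnS ltS ?sTS.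
have pow_gt0 : 0 < 2 ^+ k :> R by rewrite exprn_gt0.
rewrite exprS; have [/existsP[y /andP[yS /eqP ry]]|/existsPn noy] :=
  boolP [exists y, (y \in S) && (r y == k)].
- rewrite (big_setD1 y yS) /= ry.
  suff : \sum_(x in S :\ y) 2 ^+ r x < 2 ^+ k :> R by lra.
  apply: IH' => [|x]; first exact: subD1set.
  by rewrite in_setD1 -ry (inj_eq r_inj) => /andP[].
- suff : \sum_(x in S) 2 ^+ r x < 2 ^+ k :> R by lra.
  by apply: IH' => // x xS; have := noy x; rewrite xS.
Qed.

(** Take [h] of greatest rank: its term outweighs all the others together, so it has the sign of the
    whole sum. If another term [e g] were positive, the terms besides [h] and [g] would have
    absolute values summing to less than [e h - e g], so the sum would exceed [2 * e g], against the
    bound by [e g]. *)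
Lemma unique_positive_term S e :
  (forall x, `|e x| = 2 ^+ r x) -> 0 < \sum_(x in S) e x ->
  (forall x, x \in S -> 0 < e x -> \sum_(y in S) e y <= e x) ->
  exists2 h, h \in S & forall x, x \in S -> x != h -> e x < 0.
Proof.
move=> norm_e sum_gt0 sum_le.
have [x0 x0S] : exists x, x \in S.
  apply/set0Pn; apply: contraTneq sum_gt0 => ->.
  by rewrite big_set0 ltxx.
case: (arg_maxnP r x0S) => h hS h_max.
have lt_rest : \sum_(x in S :\ h) `|e x| < `|e h|.
  rewrite norm_e (eq_bigr _ (fun x _ => norm_e x)).
  apply: sum_distinct_pow2_lt => x /setD1P[xh xS].
  by rewrite ltn_neqAle (inj_eq r_inj) xh; apply: h_max.
have le_norm (T : {set M}) : - \sum_(x in T) `|e x| <= \sum_(x in T) e x <= \sum_(x in T) `|e x|.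
  by rewrite -ler_norml ler_norm_sum.
have eh_gt0 : 0 < e h.
  rewrite ltNge; apply/negP => eh_le0; move: sum_gt0 lt_rest (le_norm (S :\ h)).
  by rewrite (big_setD1 h hS) /= (ler0_norm eh_le0); lra.
exists h => // g gS gh; rewrite ltNge; apply/negP => eg_ge0.
have eg_gt0 : 0 < e g.
  by rewrite lt_neqAle eg_ge0 eq_sym -normr_eq0 norm_e expf_neq0 ?pnatr_eq0.
have gSh : g \in S :\ h by rewrite in_setD1 gh.
move: (sum_le g gS eg_gt0) lt_rest (le_norm (S :\ h :\ g)).
rewrite (big_setD1 h hS) /= !(big_setD1 g gSh) /= !gtr0_norm //; lra.
Qed.

End DistinctPowers.

Section Pair.
Variables (R : realFieldType) (M : finType) (u : {set M} -> R).
Implicit Types (A B S : {set M}).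

Lemma lexicographical_rank : lexicographical u ->
  exists2 r : M -> nat, injective r & forall x, `|u [set x]| = 2 ^+ r x.
Proof.
case=> _ [order [rank orderK rankK] u_order].
exists (fun x => #|M| - (rank x).+1)%N => [x y eq_xy|x].
  (* Truncated subtraction can be cancelled here because [(rank x).+1] is at most [#|M|]. *)
  apply: (can_inj rankK); apply: val_inj => /=.
  apply: succn_inj; rewrite -(subKn (ltn_ord (rank x))) eq_xy.
  exact: subKn.
have pow_ge0 k : 0 <= 2 ^+ k :> R by rewrite exprn_ge0.
by rewrite -{1}(rankK x); case: (u_order (rank x)) => ->; rewrite ?normrN ger0_norm.
Qed.

Lemma lexicographical_neq0 x : lexicographical u -> u [set x] != 0.
Proof.
case/lexicographical_rank=> r _ norm_u.
by rewrite -normr_eq0 norm_u expf_neq0 ?pnatr_eq0.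
Qed.

Lemma mms2_leP S c :
  reflect (forall P Q, P :|: Q = S -> [disjoint P & Q] ->
             Num.min (u P) (u Q) <= c)
          (mms2 u S <= c).
Proof.
apply: (iffP idP) => [le_c P Q PQ disPQ|le_c].
  apply: le_trans le_c; rewrite /mms2.
  by apply: (le_bigmax_cond _ (fun P => Num.min (u P.1) (u P.2)) (j := (P, Q)));
     rewrite inE PQ eqxx.
(* The default value of the iterated maximum is handled as the bipartition of [S] into [S] and
   [set0]. *)
apply: bigmax_le => [|[P Q]].
  by apply: le_c; rewrite ?setU0 // disjoint_sym disjoints_subset sub0set.
by rewrite inE => /andP[/eqP PQ disPQ]; apply: le_c.
Qed.

Hypothesis u_add : additive_valuation u.

Lemma additive_setU A B : [disjoint A & B] -> u (A :|: B) = u A + u B.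
Proof. by move=> disAB; rewrite (u_add (A :|: B)) (sum_setU _ disAB) -!u_add. Qed.

Lemma additive_setD1 g A : g \in A -> u (A :\ g) = u A - u [set g].
Proof.
move=> gA; apply/eqP; rewrite eq_sym subr_eq addrC.
by rewrite (u_add A) (big_setD1 g gA) /= -u_add.
Qed.

Lemma additive_setU1 g A : g \notin A -> u (g |: A) = u [set g] + u A.
Proof. by move=> gA; rewrite additive_setU // disjoints1. Qed.

(** Spreading the sum over a common superset lets two bundles be compared item by item. *)
Lemma additive_indicator S A : A \subset S ->
  u A = \sum_(x in S) (if x \in A then u [set x] else 0).
Proof.
move=> /setIidPr sAS; rewrite u_add -big_mkcondr; apply: eq_bigl => x.
by rewrite -{1}sAS inE.
Qed.

End Pair.

Section PairEquivalence.
Variables (R : realFieldType) (M : finType) (u : {set M} -> R).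
Hypothesis u_lex : lexicographical u.
Variables A B : {set M}.
Hypothesis disAB : [disjoint A & B].

Let u_add : additive_valuation u := u_lex.1.

Lemma mms2_le_EFX : mms2 u (A :|: B) <= u A -> u A < u B ->
  (forall g, g \in goods u :&: B -> u (B :\ g) <= u A) /\
  (forall g, g \in chores u :&: A -> u B <= u (A :\ g)).
Proof.
move=> /mms2_leP mms_le envy; split=> g /setIP[]; rewrite inE => ug gX.
- have gA : g \notin A by rewrite (disjointFl disAB).
  (* Goods are defined by a weak inequality, but no item has value zero. Hence [g |: A] is strictly
     better than [A], and the minimum can be at most [u A] only through [B :\ g]. *)
  have ug_gt0 : 0 < u [set g] by rewrite lt_neqAle eq_sym lexicographical_neq0.
  have := mms_le (g |: A) (B :\ g); rewrite additive_setU1 // ge_min.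
  have -> : g |: A :|: B :\ g = A :|: B.
    by rewrite setUAC setD1K // setUC.
  by move=> /(_ erefl (disjoint_setU1D1 g disAB)) /orP[]; lra.
- have gB : g \notin B by rewrite (disjointFr disAB).
  have := mms_le (A :\ g) (g |: B); rewrite additive_setU1 // additive_setD1 // ge_min.
  have -> : A :\ g :|: (g |: B) = A :|: B by rewrite setUCA setUA setD1K.
  have : [disjoint A :\ g & g |: B].
    by rewrite disjoint_sym disjoint_setU1D1 // disjoint_sym.
  by move=> dis /(_ erefl dis) /orP[]; lra.
Qed.

Lemma EFX_mms2_le :
  (u A < u B ->
   (forall g, g \in goods u :&: B -> u (B :\ g) <= u A) /\
   (forall g, g \in chores u :&: A -> u B <= u (A :\ g))) ->
  mms2 u (A :|: B) <= u A.
Proof.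
move=> efx; apply/mms2_leP => P Q PQ disPQ; rewrite ge_min.
have [leBA|envy] := leP (u B) (u A).
  (* Without envy, [u P + u Q = u A + u B] is at most [2 * u A], so the two parts cannot both exceed
     [u A]. *)
  have := additive_setU u_add disPQ; rewrite PQ (additive_setU u_add disAB) => sumE.
  by apply/orP; have [?|?] := leP (u P) (u A); [left|right; lra].
have [efx_good efx_chore] := efx envy.
have [r r_inj norm_u] := lexicographical_rank u_lex.
pose e x := if x \in B then u [set x] else - u [set x].
have sum_e : \sum_(x in A :|: B) e x = u B - u A.
  rewrite (sum_setU _ disAB) addrC (u_add B) (u_add A) -sumrN /e.
  congr (_ + _); apply: eq_bigr => x xX; first by rewrite xX.
  by rewrite (disjointFr disAB xX).
have [|||h hS h_uniq] := @unique_positive_term R M r r_inj (A :|: B) e.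
- by move=> x; rewrite /e; case: ifP => _; rewrite ?normrN norm_u.
- by rewrite sum_e subr_gt0.
(* A positive [e x] marks a good in [B] or a chore in [A]. Removing it from its bundle lowers the
   gap [u B - u A] by [e x], and EFX says that no envy is left. *)
- move=> x xS; rewrite sum_e /e; case: ifP => xB ux.
    have := efx_good x; rewrite !inE xB (ltW ux) additive_setD1 // => /(_ isT).
    by lra.
  have xA : x \in A by move: xS; rewrite inE xB orbF.
  have := efx_chore x; rewrite !inE xA -oppr_gt0 ux additive_setD1 // => /(_ isT).
  by lra.
(* Away from [h], the items of [A] have positive value and those of [B] negative value, so [A] is
   optimal term by term among subsets with the same choice on [h]. *)
have part_le (T : {set M}) : T \subset A :|: B -> (h \in T) = (h \in A) -> u T <= u A.
  move=> sTS hTA; rewrite (additive_indicator u_add sTS).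
  rewrite (additive_indicator u_add (subsetUl A B)); apply: ler_sum => x xS.
  have [->|xh] := eqVneq x h; first by rewrite hTA.
  have := h_uniq x xS xh; rewrite /e.
  case: ifP => xB; first by rewrite (disjointFl disAB xB); case: ifP; lra.
  by move: xS; rewrite inE xB orbF => ->; case: ifP; lra.
have hPQ : (h \in Q) = (h \notin P).
  have [hP|hP] := boolP (h \in P); first by rewrite (disjointFr disPQ hP).
  by move: hS; rewrite -PQ inE (negPf hP).
apply/orP; have [hPA|hPA] := eqVneq (h \in P) (h \in A).
  by left; apply: part_le => //; rewrite -PQ subsetUl.
right; apply: part_le; first by rewrite -PQ subsetUr.
by rewrite hPQ; move: hPA; do 2 case: (h \in _).
Qed.

End PairEquivalence.

Theorem lemma7 (R : realFieldType) (n : nat) (M : finType)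
    (u : 'I_n -> {set M} -> R)
    (u_lex : forall i : 'I_n, lexicographical (u i))
    (X : 'I_n -> {set M}) (X_alloc : allocation X) :
  EFX u X <-> PMMS u X.
Proof.
have [_ disX] := X_alloc; split=> [efx i j ij|pmms i j envy].
  by apply: EFX_mms2_le => //; [exact: disX | exact: efx].
(* EFX ranges over all pairs and PMMS only over distinct agents, but nobody envies themselves. *)
have ij : i != j by apply: contraTneq envy => ->; rewrite ltxx.
by apply: mms2_le_EFX => //; [exact: disX | exact: pmms].
Qed.
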